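(* For every positive integer $k$, one has $\operatorname{sxdeg}(\operatorname{CP}_k) = \operatorname{sxdeg}(\operatorname{CP}_k^\ast) \ge k$, and the equality $\operatorname{sxdeg}(\operatorname{CP}_k) = \operatorname{sxdeg}(\operatorname{CP}_k^\ast)= k$ holds if $k \le 4$.
   Context: $\mathcal{S}^j$ is the vector space of real symmetric $j\times j$ matrices, with scalar product $\langle A,B\rangle=\sum_{i,l} a_{il}b_{il}$, and $\mathcal{S}_+^j\subseteq \mathcal{S}^j$ is the cone of positive semidefinite ones. The cone of copositive matrices of size $k$ is $\operatorname{CP}_k := \{A \in \mathcal{S}^k : x^\top A x \ge 0 \text{ for all } x \in \mathbb{R}_+^k\}$, where $\mathbb{R}_+$ is the set of non-negative reals. Its dual cone is $\operatorname{CP}_k^\ast := \{B\in\mathcal{S}^k : \langle A,B\rangle \ge 0 \text{ for all } A\in \operatorname{CP}_k\}$ (the cone of completely positive matrices). For a closed convex cone $K$ in a finite-dimensional real vector space $E$, a subset $S$ of a real vector space $V$ has a $K$-lift if $S = \pi(K \cap H)$ for some affine subspace $H$ of $E$ and some linear map $\pi: E \to V$. The semidefinite extension degree $\operatorname{sxdeg}(S)$ is the smallest positive integer $j$ such that $S$ has an $(\mathcal{S}_+^j)^m$-lift for some finite positive integer $m$, where $(\mathcal{S}_+^j)^m = \mathcal{S}_+^j\times\cdots\times\mathcal{S}_+^j$ ($m$ factors); $\operatorname{sxdeg}(S):=\infty$ if there is no such $j$. *)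

(* Defs.v *)
From HB Require Import structures.
From mathcomp Require Import all_boot all_order all_algebra.
From mathcomp Require Import all_classical all_reals ereal.

Set Implicit Arguments.
Unset Strict Implicit.
Unset Printing Implicit Defensive.

Import Order.TTheory GRing.Theory Num.Theory.

Local Open Scope classical_set_scope.
Local Open Scope ring_scope.

Section SymmetricMatrices.
Variables (R : realType) (j : nat).

Definition symv : {vspace 'M[R]_j} := lker (linfun (trmx \- @idfun 'M[R]_j)).

Lemma mem_symv (A : 'M[R]_j) : (A \in symv) = (A^T == A).
Proof. by rewrite memv_ker lfunE /= subr_eq0. Qed.

Definition symM : vectType R := subvs_of symv.

Definition sprod (A B : symM) : R :=
  \sum_(i < j) \sum_(l < j) vsval A i l * vsval B i l.

Definition psd : set symM :=
  [set A | forall x : 'cV[R]_j, 0 <= (x^T *m vsval A *m x) 0 0].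

Definition copositive : set symM :=
  [set A | forall x : 'cV[R]_j, (forall i, 0 <= x i 0) ->
     0 <= (x^T *m vsval A *m x) 0 0].

Definition dual_cone (K : set symM) : set symM :=
  [set B | forall A, K A -> 0 <= sprod A B].

End SymmetricMatrices.

Arguments symM : clear implicits.
Arguments psd : clear implicits.
Arguments copositive : clear implicits.

Section Lifts.
Variable R : realType.

Definition affine_subspace (E : vectType R) (H : set E) : Prop :=
  exists (p : E) (U : {vspace E}), H = [set x | x - p \in U].

(* The notion is meant for closed convex cones K; this is not repeated here,
   as the definition makes sense for every K and is only used for the closed
   convex cones psd_power below. *)
Definition has_lift (E : vectType R) (K : set E) (V : lmodType R)
    (S : set V) : Prop :=
  exists (H : set E) (pi : {linear E -> V}),
    affine_subspace H /\ S = pi @` (K `&` H).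

Definition psd_power (j m : nat) : set {ffun 'I_m -> symM R j} :=
  [set f | forall i, psd R j (f i)].

Definition has_sdp_lift (V : lmodType R) (S : set V) (j : nat) : Prop :=
  (0 < j)%N /\ exists m : nat, (0 < m)%N /\ has_lift (@psd_power j m) S.

(* ex_minn returns the least natural number satisfying the predicate. *)
Definition sxdeg (V : lmodType R) (S : set V) : \bar int :=
  match pselect (exists j, `[< has_sdp_lift S j >]) with
  | left ex_j => (ex_minn ex_j)%:Z%:E
  | right _ => +oo%E
  end.

End Lifts.

(* Main.v *)
From HB Require Import structures.
Require Import Defs.
From mathcomp Require Import all_boot all_order all_algebra.
From mathcomp Require Import all_classical all_reals ereal.
From mathcomp Require Import zify ring lra.

(** Write CP for the cone of copositive matrices of size k, CP* for its dual,
    and K for the cone of m-tuples of positive semidefinite matrices of size j.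
    The argument rests on factorizations in the sense of Yannakakis: maps
    [a : CP* -> K] and [b : CP -> K] with [<B, A> = <a B, b A>] for all B in CP*
    and A in CP.  No linearity or continuity is asked of [a] and [b].

    Lifts of CP* of this type exist exactly when such a factorization does.
    From a factorization, CP* is the set of all B for which some z in K
    satisfies [<B, A> = <z, b A>] for every A in CP: it is contained in this
    set because of [a], and contains it because [<z, b A> >= 0]
    ([lift_of_factor]).  From a lift [CP* = pi(K :&: H)], [a] picks preimages
    under [pi], and [b A] is a dual certificate for the nonnegativity of
    [<pi z, A>] on K :&: H.  Conic duality yields the certificate only when H
    meets the interior of K; in general K is replaced by the smallest face
    containing K :&: H, cut out by a point of K :&: H of maximal rank, and the
    functional is extended by the theorem of M. Riesz ([dual_certificate],
    [factor_of_lift]).  A factorization treats CP and CP* alike, whence the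
    equality of the two degrees ([sdp_lift_dual]).

    For the lower bound, evaluate a factorization at [x x^T] for the points
    [x_t = (1, t, ..., t^(k-1))], with t a natural number, and at [c c^T], where
    c lists the coefficients of a polynomial p of degree k - 1 with roots in a
    chosen set s of k - 1 naturals.  The pairing is [p(t)^2], which vanishes
    exactly for t in s; and a vanishing scalar product of two positive
    semidefinite matrices means that their matrix product vanishes.  So for t
    outside s some block of [a (x_t x_t^T)] has a row space that is not contained
    in the sum of the row spaces of the same block over s.  If j < k, a suitable
    choice of s and t makes this impossible ([few_row_spaces_span]).

    For k <= 4, CP* is the cone of doubly nonnegative matrices (Maxfield and
    Minc), which is visibly a linear section of a power of the cone of positive
    semidefinite matrices of size k.  A doubly nonnegative matrix becomes one
    with an additional zero after a multiple of the outer square of one of its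
    columns is subtracted, and with at most four indices a zero entry at (u, v)
    splits the matrix into two doubly nonnegative ones that avoid v and u
    respectively ([split_at_zero]); induction finishes the proof
    ([dnn_dual_copositive]). *)

Set Implicit Arguments.
Unset Strict Implicit.
Unset Printing Implicit Defensive.
Import Order.TTheory GRing.Theory Num.Theory.
Local Open Scope ring_scope.

(** * Positive semidefinite matrices *)

Section PsdMatrices.
Variables (R : realType) (n : nat).
Implicit Types (A B : 'M[R]_n) (x y u : 'cV[R]_n).

Definition bform A x y : R := (x^T *m A *m y) 0 0.
Definition qform A x : R := bform A x x.

Lemma bformE A x y : bform A x y = \sum_i \sum_l x i 0 * A i l * y l 0.
Proof.
rewrite /bform !mxE exchange_big /=; apply: eq_bigr => l _.
rewrite mxE mulr_suml; apply: eq_bigr => i _; by rewrite mxE.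
Qed.

Lemma bformDl A x y u : bform A (x + y) u = bform A x u + bform A y u.
Proof. by rewrite /bform linearD /= !mulmxDl mxE. Qed.

Lemma bformDr A x y u : bform A u (x + y) = bform A u x + bform A u y.
Proof. by rewrite /bform mulmxDr mxE. Qed.

Lemma bformZl A a x y : bform A (a *: x) y = a * bform A x y.
Proof. by rewrite /bform linearZ /= -!scalemxAl mxE. Qed.

Lemma bformZr A a x y : bform A x (a *: y) = a * bform A x y.
Proof. by rewrite /bform -!scalemxAr mxE. Qed.

Lemma bform_sym A x y : A^T = A -> bform A x y = bform A y x.
Proof.
move=> sA; rewrite /bform -[in LHS](trmxK (x^T *m A *m y)) mxE.
by rewrite !trmx_mul trmxK sA mulmxA.
Qed.

Lemma qformDm A B x : qform (A + B) x = qform A x + qform B x.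
Proof. by rewrite /qform /bform mulmxDr mulmxDl mxE. Qed.

Lemma qformZm A a x : qform (a *: A) x = a * qform A x.
Proof. by rewrite /qform /bform -scalemxAr -scalemxAl mxE. Qed.

Lemma qformDZ A x y t : A^T = A ->
  qform A (x + t *: y) = qform A x + 2 * t * bform A x y + t ^+ 2 * qform A y.
Proof.
move=> sA; rewrite /qform bformDl !bformDr !bformZl !bformZr.
rewrite (bform_sym y x sA); ring.
Qed.

Lemma qform_outer x y : qform (x *m x^T) y = ((y^T *m x) 0 0) ^+ 2.
Proof.
rewrite /qform /bform mulmxA -(mulmxA (y^T *m x)) mxE big_ord1 expr2.
congr (_ * _); rewrite -[in LHS](trmxK (x^T *m y)) mxE.
by rewrite trmx_mul trmxK.
Qed.

Lemma qform_outer_ge0 x y : 0 <= qform (x *m x^T) y.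
Proof. by rewrite qform_outer sqr_ge0. Qed.

Lemma qform1E u : qform 1%:M u = \sum_i u i 0 ^+ 2.
Proof.
by rewrite /qform /bform mulmx1 mxE; apply: eq_bigr => i _; rewrite mxE expr2.
Qed.

Lemma qform1_ge0 u : 0 <= qform 1%:M u.
Proof. by rewrite qform1E sumr_ge0 // => i _; rewrite sqr_ge0. Qed.

Lemma qform1_eq0 u : qform 1%:M u = 0 -> u = 0.
Proof.
rewrite qform1E => /eqP; rewrite psumr_eq0 => [/allP h|i _]; last exact: sqr_ge0.
apply/matrixP => i j; rewrite ord1 mxE; apply/eqP.
by rewrite -(sqrf_eq0 (u i 0)); apply: h; rewrite mem_index_enum.
Qed.

Definition psdmx A := A^T = A /\ forall x, 0 <= qform A x.

Lemma psdmxD A B : psdmx A -> psdmx B -> psdmx (A + B).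
Proof.
move=> [sA pA] [sB pB]; split=> [|x]; first by rewrite linearD /= sA sB.
by rewrite qformDm addr_ge0.
Qed.

Lemma psdmxZ A a : 0 <= a -> psdmx A -> psdmx (a *: A).
Proof.
move=> a0 [sA pA]; split=> [|x]; first by rewrite linearZ /= sA.
by rewrite qformZm mulr_ge0.
Qed.

Lemma psdmx_outer x : psdmx (x *m x^T).
Proof. by split=> [|y]; rewrite ?trmx_mul ?trmxK // qform_outer_ge0. Qed.

Lemma psd_cauchy_schwarz A x y : psdmx A ->
  bform A x y ^+ 2 <= qform A x * qform A y.
Proof.
move=> [sA pA]; have h t := pA (x + t *: y).
have {}h t : 0 <= qform A x + 2 * t * bform A x y + t ^+ 2 * qform A y.
  by rewrite -qformDZ.
move: (pA x) (pA y) => x0 y0.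
have [y1|y1] := eqVneq (qform A y) 0.
  rewrite y1 mulr0; have [->|b1] := eqVneq (bform A x y) 0; first by rewrite expr2 mulr0.
  move: (h (- (qform A x + 1) / (2 * bform A x y))); rewrite y1 mulr0 addr0.
  have -> : 2 * (- (qform A x + 1) / (2 * bform A x y)) * bform A x y = - (qform A x + 1).
    by field.
  lra.
have y2 : 0 < qform A y by rewrite lt_def y1.
have := h (- bform A x y / qform A y).
have -> : qform A x + 2 * (- bform A x y / qform A y) * bform A x y +
   (- bform A x y / qform A y) ^+ 2 * qform A y
   = (qform A x * qform A y - bform A x y ^+ 2) / qform A y by field.
by rewrite pmulr_lge0 ?invr_gt0 // subr_ge0.
Qed.

(** Cauchy-Schwarz for the form of A, applied to x and A x, bounds the fourth
    power of the norm of A x by a multiple of [qform A x]. *)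
Lemma psd_ker A x : psdmx A -> qform A x = 0 -> A *m x = 0.
Proof.
move=> pA q0; have := psd_cauchy_schwarz x (A *m x) pA.
rewrite q0 mul0r; have -> : bform A x (A *m x) = qform 1%:M (A *m x).
  by rewrite /qform /bform mulmx1 trmx_mul (proj1 pA) !mulmxA.
move=> h; apply: qform1_eq0; apply/eqP.
by rewrite -sqrf_eq0; apply/eqP/le_anti; rewrite h sqr_ge0.
Qed.

(** Containments of row spaces are obtained below from vanishing quadratic
    forms, which speak of vectors on the right; this is the bridge. *)
Lemma submx_ker m1 m2 (C : 'M[R]_(m1, n)) (D : 'M[R]_(m2, n)) :
  (forall x : 'cV_n, D *m x = 0 -> C *m x = 0) -> (C <= D)%MS.
Proof.
move=> h; rewrite submxE; apply/eqP/matrixP => i j.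
have : C *m col j (cokermx D) = 0.
  by apply: h; rewrite colE mulmxA mulmx_coker mul0mx.
by rewrite colE mulmxA -colE => /matrixP/(_ i 0); rewrite !mxE.
Qed.

(** A vector in the kernel of A + B makes both nonnegative forms vanish.  This is
    what makes a point of maximal rank dominate the others. *)
Lemma psd_addS A B : psdmx A -> psdmx B -> (A <= (A + B)%R)%MS.
Proof.
move=> pA pB; apply: submx_ker => x h; apply: psd_ker => //.
have : qform (A + B) x = 0 by rewrite /qform /bform -mulmxA h mulmx0 mxE.
rewrite qformDm => /eqP; rewrite paddr_eq0 ?(proj2 pA) ?(proj2 pB) //.
by case/andP => /eqP.
Qed.

Lemma sym_sqrS A : A^T = A -> (A <= A *m A)%MS.
Proof.
move=> sA; apply: submx_ker => x h; apply: qform1_eq0.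
by rewrite /qform /bform mulmx1 trmx_mul sA -mulmxA (mulmxA A) h mulmx0 mxE.
Qed.

(** If the row space of B lies in that of the symmetric matrix A, then the form
    of B ignores the kernel of A, which is orthogonal to the image of A.  So it
    suffices to test B on the image of A.  The matrix N below acts as a
    projection onto that image: [B N = B]. *)
Lemma psd_restrict A B : A^T = A -> B^T = B -> (B <= A)%MS ->
  (forall x, 0 <= qform B (A *m x)) -> psdmx B.
Proof.
move=> sA sB /submxP[Y BE] h; split=> // x.
have /submxP[S AE] := sym_sqrS sA.
pose N := A *m S^T; have BN : B *m N = B.
  rewrite /N BE -(mulmxA Y); congr (Y *m _).
  by rewrite -[RHS]sA [in RHS]AE !trmx_mul sA mulmxA.
have NB : N^T *m B = B by rewrite -[RHS]sB -[in RHS]BN [RHS]trmx_mul sB.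
suff -> : qform B x = qform B (A *m (S^T *m x)) by [].
rewrite /qform /bform (mulmxA A) -/N [in RHS](trmx_mul N).
by rewrite -[in RHS](mulmxA x^T) NB -[in RHS](mulmxA x^T) (mulmxA B) BN mulmxA.
Qed.

Lemma qform_le_norm A : exists2 c, 0 <= c &
  forall u, `|qform A u| <= c * qform 1%:M u.
Proof.
exists (\sum_i \sum_l `|A i l|) => [|u]; first by do 2![apply: sumr_ge0 => ? _].
rewrite /qform bformE mulr_suml (le_trans (ler_norm_sum _ _ _)) // ler_sum // => i _.
rewrite mulr_suml (le_trans (ler_norm_sum _ _ _)) // ler_sum // => l _.
rewrite !normrM mulrAC mulrC ler_wpM2l //.
have le1 j : `|u j 0| ^+ 2 <= qform 1%:M u.
  rewrite real_normK ?num_real // qform1E (bigD1 j) //= lerDl.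
  by rewrite sumr_ge0 // => k _; rewrite sqr_ge0.
rewrite -/(qform _ _); have := le1 i; have := le1 l; nra.
Qed.

(** On its own image, a positive semidefinite A is definite, so it dominates every
    form there.  Compactness is avoided by a generalized inverse G of A: with
    [u = A y] and [y = G u], Cauchy-Schwarz for A bounds [|u|^4] by
    [qform A u * qform A y], and [qform A y] is at most a multiple of [|u|^2]. *)
Lemma psd_dominates A B : psdmx A -> exists2 c, 0 <= c &
  forall x, `|qform B (A *m x)| <= c * qform A (A *m x).
Proof.
move=> [sA pA]; have [c1 c10 h1] := qform_le_norm B.
have [G AGA] : exists G, A *m G *m A = A by exists (pinvmx A); rewrite mulmxKpV.
have [c2 c20 h2] := qform_le_norm G^T.
exists (c1 * c2) => [|x]; first exact: mulr_ge0.
apply: le_trans (h1 _) _; rewrite -mulrA ler_wpM2l //.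
set u := A *m x; set y := G *m u.
have Ay : A *m y = u by rewrite /y /u !mulmxA AGA.
have := psd_cauchy_schwarz u y (conj sA pA).
have -> : bform A u y = qform 1%:M u by rewrite /qform /bform mulmx1 -mulmxA Ay.
have -> : qform A y = qform G^T u.
  by rewrite /qform /bform -mulmxA Ay /y trmx_mul.
move: (h2 u) (pA u) (qform1_ge0 u) => h3 h4 h5 h6.
have := le_trans (ler_norm _) h3 => {}h3.
have [->|n0] := eqVneq (qform 1%:M u) 0; first exact: mulr_ge0.
have {n0}h5 : 0 < qform 1%:M u by rewrite lt_def n0.
rewrite -(ler_pM2r h5); nra.
Qed.

Lemma qform_delta A i : qform A (delta_mx i 0) = A i i.
Proof.
rewrite /qform bformE (bigD1 i) //= [X in _ + X]big1 => [|j ji]; last first.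
  by rewrite big1 // => l _; rewrite mxE (negPf ji) !mul0r.
rewrite addr0 (bigD1 i) //= [X in _ + X]big1 => [|l li]; last first.
  by rewrite [delta_mx i 0 l 0]mxE (negPf li) mulr0.
by rewrite !mxE !eqxx mul1r mulr1 addr0.
Qed.

Lemma psd_diag_ge0 A i : psdmx A -> 0 <= A i i.
Proof. by move=> [_ pA]; rewrite -qform_delta. Qed.

Lemma colE_delta A i l : (A *m delta_mx i 0 : 'cV_n) l 0 = A l i.
Proof. by rewrite -colE mxE. Qed.

Lemma sym_entryC A i l : A^T = A -> A i l = A l i.
Proof. by move=> sA; rewrite -{1}sA mxE. Qed.

Lemma psd_diag0 A i l : psdmx A -> A i i = 0 -> A i l = 0.
Proof.
move=> pA h; have := @psd_ker A (delta_mx i 0) pA.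
rewrite qform_delta => /(_ h) /matrixP/(_ l 0).
by rewrite colE_delta mxE (sym_entryC _ _ (proj1 pA)).
Qed.

(** What Gaussian elimination of the index i removes from A.  Division by 0 being 0,
    it is 0 if A i i = 0, in which case nothing has to be eliminated from a positive
    semidefinite A. *)
Definition pivot A i : 'M[R]_n := \matrix_(p, q) (A p i * A q i / A i i).

Lemma pivot_outer A i :
  pivot A i = (A i i)^-1 *: (col i A *m (col i A)^T).
Proof.
apply/matrixP => p q; rewrite !mxE big_ord1 !mxE; ring.
Qed.

(** Cauchy-Schwarz for A between x and the i-th unit vector. *)
Lemma psdmx_sub_outer A i t : psdmx A -> t * A i i <= 1 -> 0 <= t ->
  psdmx (A - t *: (col i A *m (col i A)^T)).
Proof.
move=> pA h t0; have [sA qA] := pA.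
split=> [|x]; first by rewrite linearB linearZ /= trmx_mul trmxK sA.
rewrite qformDm -scaleNr qformZm qform_outer.
have -> : (x^T *m col i A) 0 0 = bform A x (delta_mx i 0).
  by rewrite /bform colE mulmxA.
have := psd_cauchy_schwarz x (delta_mx i 0) pA; rewrite qform_delta.
move: (qA x) (psd_diag_ge0 i pA) => qx d0 cs.
nra.
Qed.

Lemma psd_subpivot A i : psdmx A -> psdmx (A - pivot A i).
Proof.
move=> pA; rewrite pivot_outer; apply: psdmx_sub_outer => //.
  have [->|h] := eqVneq (A i i) 0; first by rewrite mulr0 ler01.
  by rewrite mulVf.
by rewrite invr_ge0 psd_diag_ge0.
Qed.

Lemma subpivotE A i p q :
  (A - pivot A i) p q = A p q - A p i * A q i / A i i.
Proof. by rewrite !mxE. Qed.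

Definition diag_supp A : {set 'I_n} := [set i | A i i != 0].

Lemma supp_subpivot A i : psdmx A -> i \in diag_supp A ->
  diag_supp (A - pivot A i) \subset diag_supp A :\ i.
Proof.
move=> pA; rewrite inE => Ai; apply/fintype.subsetP => l; rewrite !inE subpivotE.
have [->|li] := eqVneq l i; first by rewrite mulfK // subrr eqxx.
apply: contra => /eqP Al; rewrite Al sub0r oppr_eq0.
by rewrite (psd_diag0 i pA Al) !mul0r.
Qed.

(** Gaussian elimination as an induction principle: eliminating one index after
    the other writes A as a sum of pivots, which are multiples of squares [c c^T].
    It replaces the spectral theorem. *)
Lemma psd_ind (P : 'M[R]_n -> Prop) :
  P 0 ->
  (forall A i, psdmx A -> i \in diag_supp A -> P (A - pivot A i) -> P A) ->
  forall A, psdmx A -> P A.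
Proof.
move=> P0 Pp A; move: {2}#|_|.+1 (ltnSn #|diag_supp A|) => N.
elim: N A => // N IH A ltN pA.
have [d0|[i iA]] := set_0Vmem (diag_supp A).
  suff -> : A = 0 by [].
  apply/matrixP => i l; rewrite mxE; apply: psd_diag0 => //.
  by apply/eqP/negP => /negP h; have := finset.in_set0 i; rewrite -d0 inE h.
apply: (Pp A i) => //; apply: IH; last exact: psd_subpivot.
apply: leq_ltn_trans (subset_leq_card (supp_subpivot pA iA)) _.
by move: ltN; rewrite (cardsD1 i) iA.
Qed.

Definition mxdot A B : R := \sum_i \sum_l A i l * B i l.

Lemma mxdotC A B : mxdot A B = mxdot B A.
Proof. by apply: eq_bigr => i _; apply: eq_bigr => l _; rewrite mulrC. Qed.

Lemma mxdotDl A B (C : 'M[R]_n) : mxdot (A + B) C = mxdot A C + mxdot B C.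
Proof.
rewrite /mxdot -big_split; apply: eq_bigr => i _ /=; rewrite -big_split.
by apply: eq_bigr => l _; rewrite mxE mulrDl.
Qed.

Lemma mxdotZl a A B : mxdot (a *: A) B = a * mxdot A B.
Proof.
rewrite /mxdot mulr_sumr; apply: eq_bigr => i _; rewrite mulr_sumr.
by apply: eq_bigr => l _; rewrite mxE mulrA.
Qed.

Lemma mxdot0l A : mxdot 0 A = 0.
Proof. by rewrite -(scale0r A) mxdotZl mul0r. Qed.

Lemma mxdot_outer A x : mxdot A (x *m x^T) = qform A x.
Proof.
rewrite /qform bformE; apply: eq_bigr => i _; apply: eq_bigr => l _.
rewrite mxE big_ord1 mxE; ring.
Qed.

Lemma mxdot_pivot A B i : mxdot (pivot A i) B =
  (A i i)^-1 * qform B (col i A).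
Proof. by rewrite pivot_outer mxdotZl mxdotC mxdot_outer. Qed.

Lemma mxdot_subpivot A B i : mxdot A B = mxdot (A - pivot A i) B + mxdot (pivot A i) B.
Proof. by rewrite -mxdotDl subrK. Qed.

Lemma mxdot_psd_ge0 A B : psdmx A -> psdmx B -> 0 <= mxdot A B.
Proof.
move=> pA pB; elim/psd_ind: A / pA => [|A i pA _ IH]; first by rewrite mxdot0l.
rewrite (mxdot_subpivot A B i) addr_ge0 // mxdot_pivot mulr_ge0 ?(proj2 pB) //.
by rewrite invr_ge0 psd_diag_ge0.
Qed.

(** Every pivot c c^T of A contributes [qform B c >= 0]; if all of these vanish,
    then B c = 0 for each of them by [psd_ker]. *)
Lemma mxdot_psd_eq0 A B : psdmx A -> psdmx B -> mxdot A B = 0 -> A *m B = 0.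
Proof.
move=> pA pB; elim/psd_ind: A / pA => [|A i pA iA IH]; first by rewrite mul0mx.
have c0 : 0 < (A i i)^-1.
  by rewrite invr_gt0 lt_def psd_diag_ge0 // andbT; move: iA; rewrite inE.
have pA' := psd_subpivot i pA; have [sB qB] := pB.
rewrite (mxdot_subpivot A B i) mxdot_pivot => /eqP.
rewrite paddr_eq0 ?mxdot_psd_ge0 ?mulr_ge0 ?(ltW c0) //.
case/andP=> /eqP /IH h1; rewrite mulf_eq0 (gt_eqF c0) /= => /eqP h2.
rewrite -[A in LHS](subrK (pivot A i)) mulmxDl h1 add0r pivot_outer -scalemxAl.
by rewrite -mulmxA -[B in X in _ *: X]sB -trmx_mul (psd_ker pB h2) trmx0 mulmx0 scaler0.
Qed.

End PsdMatrices.

(** * Linear algebra: extension of positive functionals, lifts from graphs *)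

(** A subspace of largest dimension among those on which P holds contains every
    solution of P.  It turns infinite systems of linear equations into objects of
    type [{vspace V}]. *)
Lemma vspace_of_pred (F : fieldType) (V : vectType F) (P : V -> Prop) :
  P 0 -> (forall a x y, P x -> P y -> P (a *: x + y)) ->
  exists U : {vspace V}, forall x, x \in U <-> P x.
Proof.
move=> P0 Plin.
pose Q n := `[< exists U : {vspace V}, (forall x, x \in U -> P x) /\ \dim U = n >].
have exQ : exists n, Q n.
  exists 0%N; apply/asboolP; exists 0%VS; split=> [x|]; last exact: dimv0.
  by rewrite memv0 => /eqP ->.
have ubQ n : Q n -> (n <= \dim {:V})%N.
  by case/asboolP=> U [_ <-]; apply/dimvS/subvf.
case: (ex_maxnP exQ ubQ) => d /asboolP[U [UP dU]] max_d.
exists U => x; split=> [|Px]; first exact: UP.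
have /max_d : Q (\dim (<[x]> + U)%VS).
  apply/asboolP; exists (<[x]> + U)%VS; split=> // y /memv_addP[_ /vlineP[a ->] [u uU ->]].
  exact/Plin/UP.
have [le eqd] := dimv_leqif_sup (addvSr <[x]> U); rewrite -dU => ge.
have : (<[x]> + U <= U)%VS by rewrite -eqd eqn_leq le ge.
by rewrite subv_add => /andP[/subvP/(_ x (memv_line x))].
Qed.

Lemma lfun_of_linear (F : fieldType) (V W : vectType F) (f : V -> W) :
  linear f -> exists g : 'Hom(V, W), g =1 f.
Proof.
move=> lin_f; pose m := GRing.isLinear.Build F V W _ f lin_f.
pose fL : {linear V -> W} := HB.pack f m.
by exists (linfun fL) => x; rewrite lfunE.
Qed.

Section Riesz.
Variables (R : realType) (E : vectType R).

Lemma hyperplane_functional (M : {vspace E}) (v : E) : v \notin M ->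
  exists phi : 'Hom(E, R^o), (forall x, x \in M -> phi x = 0) /\ phi v = 1.
Proof.
move=> vM.
have v0 : v != 0 by apply: contra vM => /eqP ->; exact: mem0v.
have cap0 : (<[v]> :&: M = 0)%VS.
  apply/eqP; rewrite -subv0; apply/subvP => x; rewrite memv_cap => /andP[].
  case/vlineP=> a ->; have [->|a0] := eqVneq a 0; first by move=> _; rewrite scale0r mem0v.
  by move=> aM; case/negP: vM; rewrite -(scalerK a0 v) memvZ.
pose pi := daddv_pi <[v]> M.
have [|phi phiE] := @lfun_of_linear _ E R^o (fun x => coord [tuple v] ord0 (pi x)).
  by move=> a x y; rewrite !linearP.
exists phi; split=> [x xM|]; rewrite phiE.
  suff -> : pi x = 0 by rewrite linear0.
  have xS : x \in (<[v]> + M)%VS by rewrite -[x]add0r memv_add ?mem0v.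
  have := daddv_pi_add cap0 xS; rewrite -/pi.
  rewrite capvC in cap0; rewrite (daddv_pi_id cap0 xM) => /eqP.
  by rewrite -subr_eq0 addrK => /eqP.
rewrite /pi daddv_pi_id ?memv_line //.
by rewrite (coord_free ord0 ord0) //= seq1_free.
Qed.

(** Extension theorem of M. Riesz, by adding one vector v at a time.  The value c
    at v has to lie above every [- l m] with [m + v] in P and below every [l m']
    with [m' - v] in P; these bounds are compatible since
    [(m + v) + (m' - v) = m + m'], and both kinds exist because e is an order
    unit. *)
Theorem riesz_extension (P : E -> Prop) (e : E) (M : {vspace E})
    (l : 'Hom(E, R^o)) :
  (forall x y, P x -> P y -> P (x + y)) ->
  (forall a x, 0 < a -> P x -> P (a *: x)) ->
  (forall v, exists2 eps : R, 0 < eps & P (e + eps *: v)) ->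
  e \in M -> (forall x, x \in M -> P x -> 0 <= l x :> R) ->
  exists l' : 'Hom(E, R^o),
    (forall x, x \in M -> l' x = l x) /\ (forall x, P x -> 0 <= l' x :> R).
Proof.
move=> PD PZ Pe; move: {2}(_ - _)%N (leqnn (\dim {:E} - \dim M)) => N.
elim: N M l => [|N IH] M l leN eM posl.
  exists l; split=> // x; apply: posl.
  have /eqP -> : M == fullv by rewrite eqEdim subvf -subn_eq0 -leqn0.
  exact: memvf.
have [Mf|] := boolP (fullv <= M)%VS.
  by exists l; split=> // x; apply: posl; move/subvP: Mf => -> //; exact: memvf.
case/subvPn=> v _ vM.
have [phi [phiM phiv]] := hyperplane_functional vM.
pose S := [set - (l m : R) | m in [set m | m \in M /\ P (m + v)]]%classic.
have Pe' w : exists2 a : R, 0 < a & P (a *: e + w).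
  have [eps eps0 h] := Pe w; exists eps^-1; first by rewrite invr_gt0.
  have := PZ eps^-1 _ _ h; rewrite invr_gt0 scalerDr scalerA mulVf ?gt_eqF //.
  by rewrite scale1r; apply.
have ubS m' : m' \in M -> P (m' - v) -> ubound S (l m' : R).
  move=> m'M Pm' _ [m [mM Pm] <-].
  have := posl (m + m') (memvD mM m'M).
  have -> : m + m' = (m + v) + (m' - v) by rewrite addrACA subrr addr0.
  move/(_ (PD _ _ Pm Pm')); rewrite addrACA subrr addr0 linearD /=.
  by move=> h; rewrite -subr_ge0 opprK addrC.
have hS : has_sup S.
  split.
    by have [a a0 h] := Pe' v; exists (- l (a *: e)), (a *: e) => //; split=> //; exact: memvZ.
  by have [a a0 h] := Pe' (- v); exists (l (a *: e)); apply: ubS => //; exact: memvZ.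
pose c := sup S.
pose l1 := l + (c - l v) *: phi.
have l1E x : l1 x = l x + (c - l v) * phi x by rewrite add_lfunE scale_lfunE.
have l1M x : x \in M -> l1 x = l x by move=> xM; rewrite l1E phiM // mulr0 addr0.
have l1v : l1 v = c by rewrite l1E phiv mulr1 addrC subrK.
have [||x|l' [l'M l'P]] := IH (M + <[v]>)%VS l1.
- have: (\dim M < \dim (M + <[v]>)%VS)%N.
    have [le eqd] := dimv_leqif_sup (addvSl M <[v]>).
    rewrite ltn_neqAle le eqd andbT; apply: contra vM => /subvP; apply.
    by apply: (subvP (addvSr M <[v]>)); exact: memv_line.
  have := dimvS (subvf (M + <[v]>)%VS); move: leN.
  move: (\dim M) (\dim (M + _)) (\dim fullv) => p q r; lia.
- by rewrite -[e]addr0 memv_add ?mem0v.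
- case/memv_addP=> m mM [_ /vlineP[s ->] ->] Px.
  rewrite linearD linearZ /= l1v l1M //.
  have [s0|s0|s0] := ltgtP s 0.
  + have h : P ((- s)^-1 *: m - v).
      have -> : (- s)^-1 *: m - v = (- s)^-1 *: (m + s *: v).
        rewrite scalerDr scalerA; congr (_ + _).
        by rewrite invrN mulNr mulVf ?lt_eqF // scaleN1r.
      by apply: PZ => //; rewrite invr_gt0 oppr_gt0.
    have : c <= l ((- s)^-1 *: m) by apply: ge_sup; [case: hS | apply: ubS => //; exact: memvZ].
    rewrite linearZ /= -[_ *: _]/(_ * _) mulrC ler_pdivlMr ?oppr_gt0 //.
    by rewrite -[_ *: _]/(_ * _); lra.
  + have h : P (s^-1 *: m + v).
      have -> : s^-1 *: m + v = s^-1 *: (m + s *: v).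
        by rewrite scalerDr scalerA mulVf ?gt_eqF // scale1r.
      by apply: PZ => //; rewrite invr_gt0.
    have : - (l (s^-1 *: m) : R) <= c.
      by apply: ub_le_sup; [case: hS | exists (s^-1 *: m) => //; split=> //; exact: memvZ].
    rewrite linearZ /= -[_ *: _]/(_ * _) -mulrN mulrC ler_pdivrMr //.
    by rewrite -[_ *: _]/(_ * _); lra.
  + by rewrite s0 scale0r addr0; apply: posl; rewrite // -[m]addr0 -[0](scale0r v) -s0.
exists l'; split=> // x xM; rewrite l'M ?l1M //.
by rewrite -[x]addr0 memv_add ?mem0v.
Qed.

(** When G projects injectively to E, its projection is a subspace H of E on which
    the first coordinate is a linear function of the second. *)
Lemma lift_of_graph (V : vectType R) (K : set E) (G : {vspace (V * E)%type}) :
  (forall x, (x, 0) \in G -> x = 0) ->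
  has_lift K [set x : V | exists z, K z /\ (x, z) \in G]%classic.
Proof.
move=> injG.
pose p2 : 'Hom(subvs_of G, E) := linfun (snd \o vsval).
pose p1 : 'Hom(subvs_of G, V) := linfun (fst \o vsval).
have ker0 : lker p2 == 0%VS.
  apply/lker0P => x y; rewrite !lfunE /= => h; apply: val_inj => /=.
  apply/eqP; rewrite -subr_eq0; set d := _ - _; apply/eqP.
  have dG : d \in G by rewrite memvB ?subvsP.
  have d2 : d.2 = 0 by rewrite raddfB /= h subrr.
  have := injG d.1; rewrite -d2 -surjective_pairing => /(_ dG) d1.
  by rewrite [d]surjective_pairing d1 d2.
have piE z : (p1 \o p2^-1)%VF z = p1 ((p2^-1)%VF z) by rewrite comp_lfunE.
exists [set z | z - 0 \in limg p2]%classic, (p1 \o p2^-1)%VF; split.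
  by exists 0, (limg p2).
apply/seteqP; split=> [x [z [Kz xzG]]|_ [z [Kz /= zH] <-]].
  have zE : p2 (vsproj G (x, z)) = z by rewrite lfunE /= vsprojK.
  exists z; last by rewrite [LHS]piE -{1}zE lker0_lfunK // lfunE /= vsprojK.
  by split=> //=; rewrite subr0 -zE memv_img ?memvf.
move: zH; rewrite subr0 => /memv_imgP[u _ zE].
exists z; split=> //; rewrite [X in (X, _)]piE zE lker0_lfunK // !lfunE /=.
by rewrite -surjective_pairing subvsP.
Qed.
End Riesz.

(** * Symmetric matrices and their powers *)

Section SymBasics.
Variables (R : realType) (n : nat).
Implicit Types A B : symM R n.

Lemma symM_tr A : (vsval A)^T = vsval A.
Proof. by apply/eqP; rewrite -mem_symv subvsP. Qed.

Definition mksym (M : 'M[R]_n) : symM R n := vsproj (symv R n) M.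

Lemma mksymK M : M^T = M -> vsval (mksym M) = M.
Proof. by move=> sM; rewrite vsprojK // mem_symv sM. Qed.

Lemma psdP A : psd R n A <-> psdmx (vsval A).
Proof. by split=> [h|[_ h]]; [split; [exact: symM_tr | exact: h] | exact: h]. Qed.

Definition outer (x : 'cV[R]_n) : symM R n := mksym (x *m x^T).

Lemma outerK x : vsval (outer x) = x *m x^T.
Proof. by rewrite mksymK // trmx_mul trmxK. Qed.

Lemma psd_outer x : psd R n (outer x).
Proof. by apply/psdP; rewrite outerK; exact: psdmx_outer. Qed.

Lemma sprodC A B : sprod A B = sprod B A.
Proof. exact: mxdotC. Qed.

Lemma sprod_outer A x : sprod A (outer x) = qform (vsval A) x.
Proof. by rewrite -[LHS]/(mxdot _ _) outerK mxdot_outer. Qed.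

Lemma sprod_linear B : linear (fun A => sprod A B : R^o).
Proof. by move=> a x y; rewrite -![sprod _ _]/(mxdot _ _) linearP /= mxdotDl mxdotZl. Qed.

Definition symdelta p q : 'M[R]_n := 2^-1 *: (delta_mx p q + delta_mx q p).

(** The matrices [symdelta p q] and [symdelta q p] coincide, so this is an expansion
    over a redundant family; it spares the choice of a basis. *)
Lemma symdelta_sum A :
  A = \sum_p \sum_q vsval A p q *: mksym (symdelta p q).
Proof.
apply: subvs_inj; rewrite linear_sum /=.
under eq_bigr => p _ do rewrite linear_sum /=.
have e p q : vsval A p q *: vsval (mksym (symdelta p q)) =
   2^-1 *: (vsval A p q *: delta_mx p q) + 2^-1 *: ((vsval A)^T q p *: delta_mx q p).
  rewrite mksymK ?mxE; last first.
    by rewrite /symdelta linearZ /= linearD /= !trmx_delta addrC.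
  by rewrite /symdelta -!scalerDr !scalerA mulrC.
under eq_bigr => p _ do under eq_bigr => q _ do rewrite e.
under eq_bigr => p _ do rewrite big_split /= -!scaler_sumr.
rewrite big_split /= -!scaler_sumr -matrix_sum_delta exchange_big /=.
rewrite -matrix_sum_delta symM_tr -scalerDr -mulr2n -scaler_nat scalerA.
by rewrite mulVf ?scale1r // pnatr_eq0.
Qed.

End SymBasics.

Section Power.
Variables (R : realType) (j m : nat).
Notation E := {ffun 'I_m -> symM R j}.
Implicit Types z w : E.

Definition esprod z w : R := \sum_i sprod (z i) (w i).

Lemma esprodC z w : esprod z w = esprod w z.
Proof. by apply: eq_bigr => i _; exact: sprodC. Qed.

Lemma esprodP w a z z' : esprod (a *: z + z') w = a * esprod z w + esprod z' w.
Proof.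
rewrite /esprod mulr_sumr -big_split; apply: eq_bigr => i _ /=.
by rewrite !ffunE; have /= -> := sprod_linear (w i) a (z i) (z' i).
Qed.

Lemma esprod_ge0 z w : psd_power z -> psd_power w -> 0 <= esprod z w.
Proof.
move=> hz hw; apply: sumr_ge0 => i _.
by apply: mxdot_psd_ge0; apply/psdP; [exact: hz | exact: hw].
Qed.

Definition block i (A : symM R j) : E := [ffun l => if l == i then A else 0].

Lemma block_linear i : linear (block i).
Proof.
move=> a x y; apply/ffunP => l; rewrite !ffunE; case: ifP => // _.
by rewrite scaler0 addr0.
Qed.

Lemma block_sum z : z = \sum_i block i (z i).
Proof.
apply/ffunP => l; rewrite sum_ffunE (bigD1 l) //= big1 => [|i il].
  by rewrite addr0 ffunE eqxx.
by rewrite ffunE eq_sym (negPf il).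
Qed.

Lemma esprod_block w i A : esprod (block i A) w = sprod A (w i).
Proof.
rewrite /esprod (bigD1 i) //= ffunE eqxx big1 ?addr0 // => l li.
by rewrite ffunE (negPf li) -[LHS]/(mxdot _ _) linear0 mxdot0l.
Qed.

Lemma power_representer (l : 'Hom(E, R^o)) : exists b, forall z, l z = esprod z b.
Proof.
pose b : E := [ffun i => mksym (\matrix_(p, q) l (block i (mksym (symdelta R p q))))].
exists b => z; rewrite {1}(block_sum z) linear_sum; apply: eq_bigr => i _.
have [g gE] := lfun_of_linear (@block_linear i).
rewrite -gE {1}(symdelta_sum (z i)) linear_sum linear_sum; apply: eq_bigr => p _ /=.
rewrite linear_sum linear_sum; apply: eq_bigr => q _ /=.
rewrite linearZ linearZ /= ffunE mksymK; first by rewrite mxE gE.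
by apply/matrixP => p' q'; rewrite !mxE /symdelta addrC.
Qed.

End Power.

(** * Facial reduction and dual certificates *)

Section DualCertificate.
Variables (R : realType) (j m : nat).
Notation E := {ffun 'I_m -> symM R j}.
Variables (p : E) (U : {vspace E}).

Definition feasible (z : E) := psd_power z /\ z - p \in U.

(** The point zs maximizes the sum of the ranks of the blocks.  The midpoint of zs
    and any feasible z has blocks whose row spaces contain those of z and of zs, so
    by maximality they are those of zs: zs lies in the relative interior of the
    smallest face containing all feasible points. *)
Lemma max_rank_point z0 : feasible z0 -> exists zs, feasible zs /\
  forall z, feasible z -> forall i, (vsval (z i) <= vsval (zs i))%MS.
Proof.
move=> f0.
pose Q n := `[< exists z, feasible z /\ (\sum_i \rank (vsval (z i)) = n)%N >].
have exQ : exists n, Q n by exists (\sum_i \rank (vsval (z0 i)))%N; apply/asboolP; exists z0.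
have ubQ n : Q n -> (n <= m * j)%N.
  case/asboolP=> z [_ <-]; rewrite -[X in (_ <= X * _)%N]card_ord -sum_nat_const.
  by apply: leq_sum => i _; exact: rank_leq_row.
case: (ex_maxnP exQ ubQ) => d /asboolP[zs [fs ds]] max_d.
exists zs; split=> // z fz.
pose y : E := 2^-1 *: (z + zs).
have fy : feasible y.
  split=> [i|].
    apply/psdP; rewrite !ffunE linearZ linearD /=; apply: psdmxZ; first by rewrite invr_ge0.
    by apply: psdmxD; apply/psdP; [case: fz | case: fs].
  have -> : y - p = 2^-1 *: ((z - p) + (zs - p)).
    rewrite addrACA -opprD scalerBr -[p + p]mulr2n -scaler_nat scalerA mulVf ?scale1r //.
  by rewrite memvZ // memvD //; [case: fz | case: fs].
have yE i : (vsval (y i) :=: (vsval (z i) + vsval (zs i))%R)%MS.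
  by rewrite !ffunE linearZ linearD /=; apply: eqmx_scale; rewrite invr_eq0 pnatr_eq0.
have zy i : (vsval (z i) <= vsval (y i))%MS.
  by rewrite yE psd_addS //; apply/psdP; [case: fz | case: fs].
have zsy i : (vsval (zs i) <= vsval (y i))%MS.
  by rewrite yE addrC psd_addS //; apply/psdP; [case: fs | case: fz].
have /max_d : Q (\sum_i \rank (vsval (y i)))%N by apply/asboolP; exists y.
rewrite -ds => le_sum i; apply: submx_trans (zy i) _.
have le_i l : (\rank (vsval (zs l)) <= \rank (vsval (y l)))%N by exact: mxrankS.
have [_ <-] := mxrank_leqif_sup (zsy i).
rewrite eqn_leq le_i /=.
move: le_sum; rewrite (bigD1 i) //= [X in (_ <= X)%N](bigD1 i) //=.
have : (\sum_(l < m | l != i) \rank (vsval (zs l)) <=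
        \sum_(l < m | l != i) \rank (vsval (y l)))%N by apply: leq_sum.
move: (\sum_(_ < _ | _) _)%N (\sum_(_ < _ | _) _)%N => a b; lia.
Qed.

(** The cone Pc below consists of the pairs (z, t) with t >= 0 for which every block
    of z is positive semidefinite on the image of the corresponding block of zs;
    it is the face of zs, made full-dimensional by adding the directions orthogonal
    to the face.  The coordinate t homogenizes the affine space.  Where Pc meets the span
    Mp of the feasible points (placed at t = 1), l is nonnegative; so the
    restriction of l to Mp extends to a functional w that is nonnegative on Pc.  It
    represents l up to a constant [w (0, 1) >= 0], which the zero z0 of l forces to
    vanish. *)
Lemma dual_certificate (l : 'Hom(E, R^o)) z0 : feasible z0 -> l z0 = 0 ->
  (forall z, feasible z -> 0 <= l z :> R) ->
  exists b, psd_power b /\ forall z, feasible z -> l z = esprod z b.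
Proof.
move=> f0 l0 lpos; have [zs [[ps pU] maxs]] := max_rank_point f0.
pose E' := (E * R^o)%type : vectType R.
pose A i := vsval (zs i).
have pA i : psdmx (A i) by apply/psdP.
pose Pc (zt : E') := 0 <= (zt.2 : R) /\
  forall i x, 0 <= qform (vsval (zt.1 i)) (A i *m x).
pose Mp (zt : E') := zt.1 - zt.2 *: zs \in U /\
  forall i, (vsval (zt.1 i) <= A i)%MS.
have [||M ME] := @vspace_of_pred _ E' Mp.
- split=> [|i] /=; first by rewrite scale0r subrr mem0v.
  by rewrite ffunE linear0 sub0mx.
- move=> a [z t] [z' t'] [/= h1 h2] [/= h1' h2']; split=> /= [|i].
    have -> : a *: z + z' - (a *: t + t') *: zs = a *: (z - t *: zs) + (z' - t' *: zs).
      by rewrite scalerDl opprD addrACA scalerBr scalerA.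
    by rewrite memvD ?memvZ.
  by rewrite !ffunE linearP /= addmx_sub ?scalemx_sub.
have [l' l'E] := @lfun_of_linear _ E' R^o (fun zt => l zt.1) (fun a x y => linearP l a x.1 y.1).
have [||v||[z t] /ME[/= h1 h2] [/= t0 h3]|w [wM wP]] :=
    @riesz_extension R E' Pc (zs, 1) M l'.
- move=> [z t] [z' t'] [/= t0 h] [/= t0' h']; split=> /= [|i x]; first exact: addr_ge0.
  by rewrite ffunE linearD /= qformDm addr_ge0.
- move=> a [z t] a0 [/= t0 h]; split=> /= [|i x]; first by apply: mulr_ge0 => //; exact: ltW.
  by rewrite ffunE linearZ /= qformZm mulr_ge0 // ltW.
- have c_ex i : exists c, 0 <= c /\
      forall x, `|qform (vsval (v.1 i)) (A i *m x)| <= c * qform (A i) (A i *m x).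
    by have [c c0 h] := psd_dominates (vsval (v.1 i)) (pA i); exists c.
  have [c cP] := choice c_ex.
  pose s := 1 + \sum_i c i + `|v.2 : R|.
  have sum0 : 0 <= \sum_i c i by apply: sumr_ge0 => i _; case: (cP i).
  have s0 : 0 < s by rewrite /s; have := normr_ge0 (v.2 : R); lra.
  exists s^-1; first by rewrite invr_gt0.
  split=> /= [|i x].
    have : `|v.2 : R| <= s by rewrite /s; lra.
    rewrite ler_norml => /andP[h _].
    rewrite -[s^-1 *: _]/(s^-1 * (v.2 : R)).
    have -> : 1 + s^-1 * (v.2 : R) = s^-1 * (s + v.2) by rewrite mulrDr mulVf ?gt_eqF.
    by apply: mulr_ge0; [rewrite invr_ge0 ltW | lra].
  rewrite !ffunE linearD linearZ /= qformDm qformZm -/(A i).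
  have [ci0 /(_ x)] := cP i.
  have le_c : c i <= s.
    rewrite /s (bigD1 i) //=; have := normr_ge0 (v.2 : R).
    have : 0 <= \sum_(l < m | l != i) c l by apply: sumr_ge0 => l0' _; case: (cP l0').
    lra.
  rewrite ler_norml => /andP[h _]; have q0 := (pA i).2 (A i *m x).
  set q := qform (A i) _ in h q0 *; set r := qform _ _ in h *.
  have -> : q + s^-1 * r = s^-1 * (s * q + r) by rewrite mulrDr mulKf ?gt_eqF.
  by apply: mulr_ge0; [rewrite invr_ge0 ltW | nra].
- by apply/ME; split=> /= [|i]; rewrite ?scale1r ?subrr ?mem0v.
- rewrite l'E /=.
  (* For t = 0, z is a direction of recession and no multiple of it need be
     feasible; but z + s zs rescales to a feasible point for every s > 0, and the
     sign of l z is found as s tends to 0. *)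
  have key s : 0 < s -> 0 <= (l z : R) + s * l zs.
    move=> s0; have ts0 : 0 < (t : R) + s by exact: ltr_wpDl.
    have /lpos : feasible ((t + s)^-1 *: (z + s *: zs)).
      split=> [i|].
        apply/psdP; rewrite !ffunE linearZ linearD linearZ /=.
        apply: psdmxZ; first by rewrite invr_ge0 ltW.
        apply: psdmxD; last exact: psdmxZ (ltW s0) (pA i).
        by apply: (@psd_restrict _ _ (A i)) => //; exact: symM_tr.
      have -> : (t + s)^-1 *: (z + s *: zs) - p =
                (t + s)^-1 *: (z - t *: zs) + (zs - p).
        have -> : z + s *: zs = (z - t *: zs) + (t + s) *: zs.
          by rewrite scalerDl addrA subrK.
        by rewrite scalerDr scalerA mulVf ?gt_eqF // scale1r addrA.
      by rewrite memvD ?memvZ.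
    by rewrite linearZ linearD linearZ /= -[_ *: _]/(_ * _) pmulr_rge0 ?invr_gt0.
  have ls0 := lpos _ (conj ps pU).
  rewrite leNgt; apply/negP => lz.
  have h0 : 0 < (l zs : R) + 1 by apply: ltr_wpDl.
  have := key (- (l z : R) / (2 * ((l zs : R) + 1))).
  rewrite divr_gt0 ?oppr_gt0 ?mulr_gt0 // => /(_ isT).
  rewrite leNgt => /negP; apply.
  have : (l zs : R) / (2 * ((l zs : R) + 1)) < 1.
    by rewrite ltr_pdivrMr ?mulr_gt0 //; lra.
  move: (l zs : R) (l z : R) lz h0 ls0 => a b; nra.
have [|g gE] := @lfun_of_linear _ E E' (fun z => (z, 0)).
  move=> a x y; have h : 0 = a *: 0 + 0 :> R^o by rewrite scaler0 addr0.
  by rewrite [X in (_, X) = _]h.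
have [b bE] := power_representer (w \o g)%VF.
have {}bE z : w (z, 0) = esprod z b by rewrite -bE comp_lfunE gE.
(* The squares x x^T, placed in a single block, belong to Pc. *)
have pb : psd_power b.
  move=> i; apply/psdP; split=> [|x]; first exact: symM_tr.
  rewrite -sprod_outer sprodC -esprod_block -bE; apply: wP; split=> //= l1 y.
  rewrite ffunE; case: ifP => _; first by rewrite outerK qform_outer_ge0.
  by rewrite linear0 /qform /bform mulmx0 mul0mx mxE.
have c0 : 0 <= w (0, 1) :> R.
  apply: wP; split=> /= [|i x]; first exact: ler01.
  by rewrite ffunE linear0 /qform /bform mulmx0 mul0mx mxE.
have lE z : feasible z -> l z = esprod z b + w (0, 1).
  move=> [pz zU]; have addE : ((z, 0) + (0, 1) : E') = (z, 1).
    by rewrite -[LHS]/((z + 0, 0 + 1)) addr0 add0r.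
  rewrite -bE; transitivity (w ((z, 0) + (0, 1) : E')); last exact: linearD.
  rewrite addE wM ?l'E //; apply/ME; split=> [|i] /=; last exact: maxs.
  by rewrite scale1r -(subrK p z) -addrA -(opprB zs) memvB.
have := lE _ f0; rewrite l0 => /esym/eqP; rewrite paddr_eq0 ?esprod_ge0 //; last by case: f0.
case/andP=> _ /eqP cE; exists b; split=> // z fz; by rewrite lE // cE addr0.
Qed.
End DualCertificate.

(** * Lifts and factorizations *)

Section Factorization.
Variables (R : realType) (j m k : nat).
Notation E := {ffun 'I_m -> symM R j}.
Implicit Types C D : set (symM R k).

(** A factorization through the cone of positive semidefinite tuples of the
    slack operator, that is, of the pairing between C and D. *)
Definition factorizable C D := exists a b : symM R k -> E,
  [/\ forall x, C x -> psd_power (a x), forall y, D y -> psd_power (b y)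
    & forall x y, C x -> D y -> sprod x y = esprod (a x) (b y)].

Lemma factorizable_sym C D : factorizable C D -> factorizable D C.
Proof.
move=> [a [b [pa pb h]]]; exists b, a; split=> // x y Dx Cy.
by rewrite sprodC h // esprodC.
Qed.

(** Preimages under the lift map give a, dual certificates give b; the preimage of 0
    is the zero that [dual_certificate] asks for. *)
Lemma factor_of_lift C D : has_lift (@psd_power R j m) C -> C 0 ->
  (forall x y, C x -> D y -> 0 <= sprod x y) -> factorizable C D.
Proof.
move=> [H [pi [[p [U ->]] CE]]] C0 CD.
have lift_ex x : exists z, C x -> feasible p U z /\ pi z = x.
  have [Cx|nC] := pselect (C x); last by exists 0.
  by move: Cx; rewrite {1}CE => -[z fz zx]; exists z.
have [a aP] := choice lift_ex.
have dual_ex y : exists b, D y -> psd_power b /\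
    forall z, feasible p U z -> sprod (pi z) y = esprod z b.
  have [Dy|nD] := pselect (D y); last by exists 0.
  have [l lE] := @lfun_of_linear _ E R^o (fun z => sprod (pi z) y)
    (fun c z z' => etrans (congr1 (fun u => sprod u y) (linearP pi c z z'))
                          (sprod_linear y c (pi z) (pi z'))).
  have [f0 pi0] := aP _ C0.
  have [||b [pb bE]] := dual_certificate (l := l) f0.
  - by rewrite lE pi0 -[LHS]/(mxdot _ _) linear0 mxdot0l.
  - by move=> z fz; rewrite lE; apply: CD Dy; rewrite CE; exists z.
  by exists b => _; split=> // z /bE <-; rewrite lE.
have [b bP] := choice dual_ex.
exists a, b; split=> [x /aP[[]]|y /bP[]|x y Cx Dy] //.
by have [fx {1}<-] := aP _ Cx; have [_ ->] := bP _ Dy.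
Qed.

(** Closedness of the projection of K is no issue: the equations
    [sprod x y = esprod z (b y)] with z in K force x to pair nonnegatively with D. *)
Lemma lift_of_factor C D : factorizable C D ->
  (forall x, (forall y, D y -> 0 <= sprod x y) -> C x) ->
  (forall x, (forall y, D y -> sprod x y = 0) -> x = 0) ->
  has_lift (@psd_power R j m) C.
Proof.
move=> [a [b [pa pb h]]] bipolar sep.
have [||G GE] := @vspace_of_pred _ (symM R k * E)%type
    (fun xz => forall y, D y -> sprod xz.1 y = esprod xz.2 (b y)).
- move=> y _ /=; rewrite -[LHS]/(mxdot _ _) linear0 mxdot0l /esprod big1 // => i _.
  by rewrite -[LHS]/(mxdot _ _) ffunE linear0 mxdot0l.
- move=> c [x z] [x' z'] /= h1 h2 y Dy; rewrite esprodP -h1 // -h2 //.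
  exact: sprod_linear.
suff -> : C = [set x | exists z, psd_power z /\ (x, z) \in G]%classic.
  apply: lift_of_graph => x /GE /= x0; apply: sep => y Dy.
  rewrite x0 // /esprod big1 // => i _; by rewrite -[LHS]/(mxdot _ _) ffunE linear0 mxdot0l.
apply/seteqP; split=> [x Cx|x [z [pz /GE /= xz]]].
  by exists (a x); split; [exact: pa | apply/GE => y; exact: h].
by apply: bipolar => y Dy; rewrite xz // esprod_ge0 //; exact: pb.
Qed.

End Factorization.

Section CopositiveDuality.
Variables (R : realType) (k : nat).

Lemma copositive_outer (c : 'cV[R]_k) : copositive R k (outer c).
Proof. by move=> x _; have [_] := (psdP _).1 (psd_outer c); exact. Qed.

Lemma dual_copositive_outer (x : 'cV[R]_k) : (forall i, 0 <= x i 0) ->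
  dual_cone (copositive R k) (outer x).
Proof. by move=> x0 A cA; rewrite sprod_outer; exact: cA. Qed.

Lemma copositive_bipolar (A : symM R k) :
  (forall B, dual_cone (copositive R k) B -> 0 <= sprod A B) -> copositive R k A.
Proof. by move=> h x /dual_copositive_outer /h; rewrite sprod_outer. Qed.

(** Polarization between unit vectors. *)
Lemma nonneg_outer_separating (A : symM R k) :
  (forall x : 'cV[R]_k, (forall i, 0 <= x i 0) -> sprod A (outer x) = 0) -> A = 0.
Proof.
move=> h; apply: subvs_inj; apply/matrixP => i l; rewrite mxE.
have q (x : 'cV[R]_k) : (forall i, 0 <= x i 0) -> qform (vsval A) x = 0.
  by move=> x0; rewrite -sprod_outer h.
have d0 r s : 0 <= (delta_mx r 0 : 'cV[R]_k) s 0 by rewrite mxE ler0n.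
have := qformDZ (delta_mx i 0) (delta_mx l 0) 1 (symM_tr A).
rewrite scale1r !q // => [|s]; last by rewrite mxE addr_ge0.
rewrite !mulr0 add0r addr0 mulr1 => /esym/eqP; rewrite mulf_eq0 pnatr_eq0 /= => /eqP.
rewrite /bform -mulmxA -colE mxE (bigD1 i) //= big1 => [|s si].
  by rewrite !mxE !eqxx addr0 mul1r.
by rewrite !mxE (negPf si) mul0r.
Qed.

(** Factorizations are symmetric in the two cones.  A matrix is copositive as soon
    as it pairs nonnegatively with the squares of nonnegative vectors, so either
    cone is the dual of the other. *)
Lemma sdp_lift_dual j : has_sdp_lift (copositive R k) j <->
  has_sdp_lift (dual_cone (copositive R k)) j.
Proof.
have zero_sprod (B : symM R k) : sprod 0 B = 0.
  by rewrite -[LHS]/(mxdot _ _) linear0 mxdot0l.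
split=> -[j0 [m [m0 hl]]]; split=> //; exists m; split=> //.
  apply: (@lift_of_factor _ _ _ _ _ (copositive R k)).
  - apply/factorizable_sym/factor_of_lift => //.
      by move=> x _; rewrite -[X in 0 <= X]/(qform _ _) -sprod_outer zero_sprod.
    by move=> x y cx; exact.
  - by move=> x h y cy; rewrite sprodC; exact: h.
  - by move=> x h; apply: nonneg_outer_separating => y _; apply: h; exact: copositive_outer.
apply: (@lift_of_factor _ _ _ _ _ (dual_cone (copositive R k))).
- apply/factorizable_sym/factor_of_lift => //.
    by move=> x _; rewrite sprodC zero_sprod.
  by move=> x y dx cy; rewrite sprodC; exact: dx.
- exact: copositive_bipolar.
- by move=> x h; apply: nonneg_outer_separating => y y0; apply: h; exact: dual_copositive_outer.
Qed.

End CopositiveDuality.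

(** * The lower bound *)

(** Choose an infinite set Q of indices and spaces W i containing all L i t with t
    in Q, such that the total dimension of the W i is least.  Then a proper subspace
    of W i contains L i t for only finitely many t in Q, as otherwise W i could be
    replaced by it.  So indices of Q can be picked one by one such that each
    new one enlarges, for every i, the sum of the chosen L i r unless this sum is
    already W i.  After d >= j picks all these sums are equal to W i. *)
Lemma few_row_spaces_span (F : fieldType) (j m d : nat) (L : 'I_m -> nat -> 'M[F]_j) :
  (j <= d)%N -> exists (s : seq nat) (t : nat), [/\ size s = d, t \notin s
    & forall i, (L i t <= \sum_(r <- s) L i r)%MS].
Proof.
move=> jd.
pose good (Q : nat -> Prop) (W : 'I_m -> 'M[F]_j) :=
  (forall n, exists2 t, (n < t)%N & Q t) /\ forall i t, Q t -> (L i t <= W i)%MS.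
pose N n := `[< exists Q W, good Q W /\ (\sum_i \rank (W i) = n)%N >].
have exN : exists n, N n.
  exists (\sum_(i < m) \rank (1%:M : 'M[F]_j))%N; apply/asboolP.
  exists (fun=> True), (fun=> 1%:M); split=> //; split=> [n|i t _]; last exact: submx1.
  by exists n.+1.
case: (ex_minnP exN) => n0 /asboolP[Q [W [[infQ LW] rkW]]] min_n.
pose S s i := (\sum_(r <- s) L i r)%MS.
have finite_bad s i : exists b, ~~ (W i <= S s i)%MS -> (S s i <= W i)%MS ->
    forall t, Q t -> (L i t <= S s i)%MS -> (t <= b)%N.
  apply: contrapT => nb.
  have [nWS [SW infS]] : ~~ (W i <= S s i)%MS /\ (S s i <= W i)%MS /\
      forall b, exists2 t, (b < t)%N & Q t /\ (L i t <= S s i)%MS.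
    split; [|split].
    - by apply/negP => h; apply: nb; exists 0%N; rewrite h.
    - by apply: contrapT => h; apply: nb; exists 0%N => _ h'.
    move=> b; apply: contrapT => nt; apply: nb; exists b => _ _ t Qt Lt.
    by rewrite leqNgt; apply/negP => bt; apply: nt; exists t.
  pose W' l := if l == i then S s i else W l.
  have /min_n : N (\sum_l \rank (W' l))%N.
    apply/asboolP; exists (fun t => Q t /\ (L i t <= S s i)%MS), W'; split=> //.
    split=> [|l t [Qt Lt]]; first exact: infS.
    by rewrite /W'; case: eqP => [->|_] //; exact: LW.
  have eW' : (\sum_(l < m | l != i) \rank (W' l) = \sum_(l < m | l != i) \rank (W l))%N.
    by apply: eq_bigr => l /negPf li; rewrite /W' li.
  rewrite -rkW (bigD1 i) //= [X in (_ <= X)%N](bigD1 i) //= eW' {1}/W' eqxx.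
  by rewrite leq_add2r leqNgt (ltn_leqif (mxrank_leqif_sup SW)) nWS.
have build n : exists s, [/\ size s = n, forall r, r \in s -> Q r
    & forall i, (W i <= S s i)%MS \/ (n <= \rank (S s i))%N].
  elim: n => [|n [s [szs sQ sW]]]; first by exists [::]; split=> // i; right.
  have SW i : (S s i <= W i)%MS.
    rewrite /S big_seq_cond big_mkcond /=.
    by elim/big_ind: _ => [|A B hA hB|r _]; [exact: sub0mx|rewrite addsmx_sub hA|
      case: ifP => [/andP[rs _]|_]; [exact/LW/sQ | exact: sub0mx]].
  have [b bP] := choice (finite_bad s).
  have [t bt Qt] := infQ (\sum_i b i)%N.
  exists (t :: s); split=> [|r|i]; first by rewrite /= szs.
    by rewrite inE => /orP[/eqP ->|/sQ].
  have SS : (S s i <= S (t :: s) i)%MS by rewrite /S big_cons addsmxSr.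
  have [WS|nWS] := boolP (W i <= S s i)%MS; first by left; exact: submx_trans SS.
  right; have [h|h] := sW i; first by rewrite h in nWS.
  apply: leq_ltn_trans h _; rewrite (ltn_leqif (mxrank_leqif_sup SS)).
  rewrite /S big_cons addsmx_sub negb_and; apply/orP; left; apply/negP => Lt.
  have := bP i nWS (SW i) t Qt Lt; rewrite leqNgt => /negP; apply.
  by apply: leq_ltn_trans bt; rewrite (bigD1 i) //= leq_addr.
have [s [szs sQ sW]] := build d.
have [t st Qt] := infQ (\sum_(r <- s) r)%N.
exists s, t; split=> // [|i].
  apply/negP => ts; move: st; rewrite ltnNge => /negP; apply.
  by rewrite (big_rem t) //= leq_addr.
apply: submx_trans (LW i t Qt) _; have [//|h] := sW i.
by apply: submx_full; rewrite /row_full eqn_leq rank_leq_col (leq_trans jd).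
Qed.

Section LowerBound.
Variables (R : realType) (k : nat).

Definition moment_point (t : nat) : 'cV[R]_k := \col_i (t%:R ^+ i).

Lemma moment_pointE (p : {poly R}) t : (size p <= k)%N ->
  ((\col_(i < k) p`_i)^T *m moment_point t) 0 0 = p.[t%:R].
Proof.
by move=> sp; rewrite (horner_coef_wide _ sp) mxE; apply: eq_bigr => i _; rewrite !mxE.
Qed.

(** The pairing of [x_r x_r^T] with [c c^T] is [p.[r] ^+ 2].  At the roots r in s,
    all blocks of the two images multiply to 0; the row space inclusion carries
    this over to t, although t is not a root of p. *)
Lemma factor_lower_bound j m :
  factorizable j m (dual_cone (copositive R k)) (copositive R k) -> (k <= j)%N.
Proof.
case=> a [b [pa pb h]]; rewrite leqNgt; apply/negP => jk.
pose X t := outer (moment_point t).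
have dX t : dual_cone (copositive R k) (X t).
  by apply: dual_copositive_outer => i; rewrite mxE exprn_ge0.
have [|s [t [szs ts tS]]] :=
  @few_row_spaces_span R j m k.-1 (fun i t => vsval (a (X t) i)); first lia.
pose p : {poly R} := \prod_(r <- s) ('X - (r%:R : R)%:P).
have sp : (size p <= k)%N by rewrite /p size_prod_XsubC szs prednK //; lia.
pose c := \col_(i < k) p`_i.
have root_p x : root p x = (x \in [seq r%:R | r <- s]).
  by rewrite /p -(big_map (fun r => r%:R) xpredT (fun r => 'X - r%:P)) root_prod_XsubC.
have val r : esprod (a (X r)) (b (outer c)) = p.[r%:R] ^+ 2.
  rewrite -h //; last exact: copositive_outer.
  by rewrite sprodC sprod_outer outerK qform_outer -[in LHS](trmxK (_ *m _)) mxE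
    trmx_mul trmxK moment_pointE.
have pX r i : psdmx (vsval (a (X r) i)) by apply/psdP/pa.
have pB i : psdmx (vsval (b (outer c) i)) by apply/psdP/pb/copositive_outer.
have ortho r i : r \in s -> vsval (a (X r) i) *m vsval (b (outer c) i) = 0.
  move=> rs; apply: mxdot_psd_eq0 => //; move: (val r).
  (* r is a root of p, so the sum of the nonnegative pairings of blocks is 0. *)
  have -> : p.[r%:R] = 0.
    by apply/eqP; rewrite -[_ == 0]/(root p _) root_p map_f.
  rewrite expr0n /= => /eqP; rewrite psumr_eq0 => [/allP/(_ i)|l _]; last exact: mxdot_psd_ge0.
  by rewrite mem_index_enum => /(_ isT)/eqP.
have : p.[t%:R] ^+ 2 == 0.
  rewrite -val /esprod big1 // => i _; rewrite -[LHS]/(mxdot _ _).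
  have : vsval (a (X t) i) *m vsval (b (outer c) i) = 0.
    apply/eqP; rewrite -sub_kermx; apply: submx_trans (tS i) _.
    rewrite big_seq_cond big_mkcond /=.
    elim/big_ind: _ => [|A B hA hB|r _]; [exact: sub0mx|by rewrite addsmx_sub hA|].
    case: ifP => [/andP[rs _]|_]; last exact: sub0mx.
    by rewrite sub_kermx ortho.
  move=> AB0; transitivity (\tr (vsval (a (X t) i) *m vsval (b (outer c) i))).
    rewrite /mxtrace; apply: eq_bigr => r _; rewrite mxE; apply: eq_bigr => l _.
    by rewrite (sym_entryC _ _ (symM_tr (b _ i))).
  by rewrite AB0 mxtrace0.
rewrite sqrf_eq0 -[_ == 0]/(root p _) root_p.
by rewrite mem_map ?(negPf ts) //; exact: mulrIn (oner_neq0 R).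
Qed.

End LowerBound.

(** * Doubly nonnegative matrices of small support *)

Section DoublyNonnegative.
Variables (R : realType) (n : nat).
Implicit Types (A B : 'M[R]_n).

Definition doubly_nonneg B := psdmx B /\ forall i l, 0 <= B i l.

Definition copositive_mx A := forall x : 'cV[R]_n, (forall i, 0 <= x i 0) -> 0 <= qform A x.

(** Membership in the dual cone is all that is used of complete positivity, so
    explicit decompositions into squares of nonnegative vectors are not kept. *)
Definition dual_copositive_mx B := forall A, copositive_mx A -> 0 <= mxdot A B.

Lemma dual_copositive_mxD B B' :
  dual_copositive_mx B -> dual_copositive_mx B' -> dual_copositive_mx (B + B').
Proof. by move=> h h' A cA; rewrite mxdotC mxdotDl addr_ge0 // mxdotC; [exact: h | exact: h']. Qed.

Lemma dual_copositive_mx_outer t (x : 'cV[R]_n) : 0 <= t -> (forall i, 0 <= x i 0) ->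
  dual_copositive_mx (t *: (x *m x^T)).
Proof. by move=> t0 x0 A cA; rewrite mxdotC mxdotZl mxdotC mxdot_outer mulr_ge0 //; exact: cA. Qed.

Lemma dnn_offdiag B : psdmx B -> (forall i l, i != l -> 0 <= B i l) -> doubly_nonneg B.
Proof.
move=> pB h; split=> // i l; have [->|] := eqVneq i l; last exact: h.
exact: psd_diag_ge0.
Qed.

Lemma dnn_supp B i l : doubly_nonneg B -> B i l != 0 -> i \in diag_supp B /\ l \in diag_supp B.
Proof.
move=> [pB _] h; rewrite !inE; split; apply: contra h => /eqP h; apply/eqP.
  exact: psd_diag0.
by rewrite (sym_entryC _ _ (proj1 pB)); exact: psd_diag0.
Qed.

Lemma dnn_supp0 B i l : doubly_nonneg B -> i \notin diag_supp B -> B i l = 0.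
Proof. by move=> dB; have [//|/(dnn_supp dB)[->]] := eqVneq (B i l) 0. Qed.

(** The largest t for which the off-diagonal entries stay nonnegative creates a
    zero.  It is at most [1 / B u u], the value at which the entry (u, l) vanishes,
    and up to that value the difference stays positive semidefinite. *)
Lemma reduce_to_zero B u l : doubly_nonneg B -> u != l -> B u l != 0 ->
  exists t, [/\ 0 <= t, doubly_nonneg (B - t *: (col u B *m (col u B)^T))
    & exists p q, [/\ p != q, p \in diag_supp B, q \in diag_supp B
        & (B - t *: (col u B *m (col u B)^T)) p q = 0]].
Proof.
move=> dB ul Bul; have [pB B0] := dB; have sB := sym_entryC _ _ (proj1 pB).
have [uS lS] := dnn_supp dB Bul.
have Buu : B u u != 0 by move: uS; rewrite inE.
have cE t p q : (B - t *: (col u B *m (col u B)^T)) p q = B p q - t * (B p u * B q u).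
  by rewrite !mxE big_ord1 !mxE.
pose T (pq : 'I_n * 'I_n) := (pq.1 != pq.2) && (B pq.1 u * B pq.2 u != 0).
pose F (pq : 'I_n * 'I_n) : R := B pq.1 pq.2 / (B pq.1 u * B pq.2 u).
have T0 : T (u, l) by rewrite /T /= ul mulf_neq0 // sB.
case: (arg_minP F T0) => -[p q] /andP[/= pq npq] minF.
have tu : F (p, q) * B u u <= 1.
  have := minF _ T0; rewrite {2}/F /= (sB l u) => h.
  apply: le_trans (ler_wpM2r (B0 u u) h) _.
  by rewrite invfM mulrCA mulfV // mulr1 mulVf.
have t0 : 0 <= F (p, q) by rewrite /F divr_ge0 ?mulr_ge0.
exists (F (p, q)); split=> //.
  apply: dnn_offdiag => [|i k ik]; first exact: psdmx_sub_outer.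
  rewrite cE; have [->|nik] := eqVneq (B i u * B k u) 0; first by rewrite mulr0 subr0.
  have := minF (i, k); rewrite /T /= ik nik => /(_ isT); rewrite {2}/F /=.
  by rewrite ler_pdivlMr ?lt_def ?nik ?mulr_ge0 // subr_ge0.
move: npq; rewrite mulf_eq0 negb_or => /andP[pu qu].
exists p, q; split=> //; first by have [] := dnn_supp dB pu.
  by have [] := dnn_supp dB qu.
by rewrite cE /F /= mulfVK ?subrr // mulf_neq0.
Qed.

(** Unless a + b = 0, take c = a / (a + b), which makes both nonnegative multiples of
    [a + b + r]. *)
Lemma split_coef (a b r : R) : 0 <= a -> 0 <= b -> 0 <= a + b + r ->
  exists2 c, 0 <= c <= 1 & 0 <= a + c * r /\ 0 <= b + (1 - c) * r.
Proof.
move=> a0 b0 h; have [ab|ab] := eqVneq (a + b) 0.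
  by exists 0; [rewrite lexx ler01 | split; lra].
have ab0 : 0 < a + b by rewrite lt_def ab addr_ge0.
exists (a / (a + b)).
  rewrite (divr_ge0 a0 (ltW ab0)) /= ler_pdivrMr // mul1r; lra.
split.
  have -> : a + a / (a + b) * r = a * (a + b + r) / (a + b) by field.
  by apply: divr_ge0; [exact: mulr_ge0 | exact: ltW].
have -> : b + (1 - a / (a + b)) * r = b * (a + b + r) / (a + b) by field.
by apply: divr_ge0; [exact: mulr_ge0 | exact: ltW].
Qed.

Lemma card_le2 (D : {set 'I_n}) (u : 'I_n) : (#|D| <= 2)%N ->
  exists w z, forall p, p \in D -> p = w \/ p = z.
Proof.
move=> D2; have [->|[w wD]] := set_0Vmem D; first by exists u, u => p; rewrite inE.
have [D0|[z zD]] := set_0Vmem (D :\ w).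
  exists w, w => p pD; left; apply/eqP; apply: contraT => pw.
  by have := finset.in_set0 p; rewrite -D0 !inE pw pD.
exists w, z => p pD; have [->|pw] := eqVneq p w; first by left.
right; apply/eqP; apply: contraT => pz.
move: D2; rewrite (cardsD1 w) wD (cardsD1 z) zD (cardsD1 p).
by rewrite !inE pw pz pD.
Qed.

(** As B u v = 0, the indices u and v can be eliminated independently, leaving
    [B = pivot B u + pivot B v + Q].  At most two indices w, z remain, so Q has
    a single off-diagonal entry, which may be negative; [split_coef] distributes Q
    over the two pivots in such a way that both sums are nonnegative at (w, z).
    This is where the bound 4 enters. *)
Lemma split_at_zero B u v : doubly_nonneg B -> u != v -> B u v = 0 ->
  u \in diag_supp B -> v \in diag_supp B -> (#|diag_supp B| <= 4)%N ->
  exists B1 B2, [/\ B = B1 + B2, doubly_nonneg B1, doubly_nonneg B2,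
    diag_supp B1 \subset diag_supp B :\ v & diag_supp B2 \subset diag_supp B :\ u].
Proof.
move=> dB uv Buv uS vS S4; have [pB B0] := dB; have sB := sym_entryC _ _ (proj1 pB).
have Bvu : B v u = 0 by rewrite sB.
have [nu nv] : B u u != 0 /\ B v v != 0 by move: uS vS; rewrite !inE.
have [w [z wz]] : exists w z, forall p, p \in diag_supp B :\ u :\ v -> p = w \/ p = z.
  by apply: card_le2 => //; move: S4; rewrite (cardsD1 u) uS (cardsD1 v) !inE eq_sym uv nv.
have pE : pivot (B - pivot B u) v = pivot B v.
  by apply/matrixP => p q; rewrite !mxE Bvu !(mulr0, mul0r) !subr0.
pose Q := B - pivot B u - pivot B v.
have pQ : psdmx Q by rewrite /Q -pE; do 2![apply: psd_subpivot].
have sQ := sym_entryC _ _ (proj1 pQ).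
have QE p q : Q p q = B p q - B p u * B q u / B u u - B p v * B q v / B v v.
  by rewrite !mxE.
have Qu q : Q u q = 0 by rewrite QE Buv !mul0r subr0 mulrAC mulfV // mul1r sB subrr.
have Qv q : Q v q = 0.
  by rewrite QE Bvu !mul0r subr0 mulrAC mulfV // mul1r (sB q) subrr.
have QS p q : p \notin diag_supp B -> Q p q = 0.
  by move=> pS; rewrite QE !(dnn_supp0 _ dB pS) !mul0r !subr0.
have piv0 i p q : 0 <= pivot B i p q by rewrite mxE divr_ge0 ?mulr_ge0.
have ppiv i : psdmx (pivot B i).
  rewrite pivot_outer; apply: psdmxZ; last exact: psdmx_outer.
  by rewrite invr_ge0.
have [|c /andP[c0 c1] [cu cv]] := split_coef (piv0 u w z) (piv0 v w z) (r := Q w z).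
  by rewrite QE !mxE; move: (B0 w z); lra.
have key i d : 0 <= d -> 0 <= pivot B i w z + d * Q w z -> doubly_nonneg (pivot B i + d *: Q).
  move=> d0 h; apply: dnn_offdiag => [|p q pq].
    by apply: psdmxD => //; exact: psdmxZ.
  rewrite mxE [X in _ + X]mxE.
  have zero : Q p q = 0 -> 0 <= pivot B i p q + d * Q p q.
    by move=> ->; rewrite mulr0 addr0.
  have [->|pu] := eqVneq p u; first by rewrite Qu mulr0 addr0.
  have [->|pv] := eqVneq p v; first by rewrite Qv mulr0 addr0.
  have [pS|pS] := boolP (p \in diag_supp B); last exact/zero/QS.
  have [->|qu] := eqVneq q u; first by rewrite sQ Qu mulr0 addr0.
  have [->|qv] := eqVneq q v; first by rewrite sQ Qv mulr0 addr0.
  have [qS|qS] := boolP (q \in diag_supp B); last by apply: zero; rewrite sQ QS.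
  have pD : p \in diag_supp B :\ u :\ v by rewrite in_setD1 in_setD1 pu pv.
  have qD : q \in diag_supp B :\ u :\ v by rewrite in_setD1 in_setD1 qu qv.
  have [ep|ep] := wz p pD; have [eq|eq] := wz q qD; subst p q => //.
  - by rewrite eqxx in pq.
  - by rewrite sQ (sym_entryC z w (proj1 (ppiv i))).
  - by rewrite eqxx in pq.
have suppS i k d : doubly_nonneg (pivot B i + d *: Q) -> B k i = 0 -> (forall q, Q k q = 0) ->
    diag_supp (pivot B i + d *: Q) \subset diag_supp B :\ k.
  move=> _ Bki Qk; apply/fintype.subsetP => p; rewrite in_setD1 !inE.
  have [->|pk] := eqVneq p k.
    by rewrite mxE [X in _ + X]mxE Qk !mxE Bki !mul0r mulr0 addr0 eqxx.
  apply: contra => /eqP Bp; have pS : p \notin diag_supp B by rewrite inE Bp eqxx.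
  by rewrite mxE [X in _ + X]mxE (QS _ _ pS) !mxE !(dnn_supp0 _ dB pS) !mul0r mulr0 addr0.
have d1 := key u c c0 cu; have d2 : doubly_nonneg (pivot B v + (1 - c) *: Q).
  by apply: key => //; rewrite subr_ge0.
exists (pivot B u + c *: Q), (pivot B v + (1 - c) *: Q); split=> //.
- rewrite addrACA -scalerDl [c + _]addrC subrK scale1r /Q.
  by apply/matrixP => p q; rewrite !mxE; ring.
- exact: suppS.
- exact: suppS.
Qed.

(** Induction on the support.  A matrix with a zero off-diagonal entry inside its
    support splits into two of smaller support; any other one is brought to this
    case, or to smaller support, by [reduce_to_zero]. *)
Theorem dnn_dual_copositive B : doubly_nonneg B -> (#|diag_supp B| <= 4)%N -> dual_copositive_mx B.
Proof.
move: {2}#|_|.+1 (ltnSn #|diag_supp B|) => N; elim: N B => // N IH B ltN dB S4.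
have zero_case B' u v :
    doubly_nonneg B' -> diag_supp B' \subset diag_supp B -> u != v -> B' u v = 0 ->
    u \in diag_supp B' -> v \in diag_supp B' -> dual_copositive_mx B'.
  move=> dB' S' uv Buv uS vS; have leS := subset_leq_card S'.
  have [B1 [B2 [BE d1 d2 s1 s2]]] := split_at_zero dB' uv Buv uS vS (leq_trans leS S4).
  have lt1 : (#|diag_supp B1| < #|diag_supp B'|)%N.
    by rewrite [X in (_ < X)%N](cardsD1 v) vS ltnS subset_leq_card.
  have lt2 : (#|diag_supp B2| < #|diag_supp B'|)%N.
    by rewrite [X in (_ < X)%N](cardsD1 u) uS ltnS subset_leq_card.
  have step B0 : doubly_nonneg B0 -> (#|diag_supp B0| < #|diag_supp B'|)%N -> dual_copositive_mx B0.
    move=> d0 lt0; have lt0' := leq_trans lt0 leS.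
    by apply: IH => //; [exact: leq_trans lt0' (ltnSE ltN) | exact: leq_trans (ltnW lt0') S4].
  by rewrite BE; apply: dual_copositive_mxD; apply: step.
have [S0|[u uS]] := set_0Vmem (diag_supp B).
  suff -> : B = 0 by move=> A _; rewrite mxdotC mxdot0l.
  by apply/matrixP => i l; rewrite mxE dnn_supp0 // S0 finset.in_set0.
have [S1|[l]] := set_0Vmem (diag_supp B :\ u).
  pose e : 'cV[R]_n := delta_mx u 0; suff -> : B = B u u *: (e *m e^T).
    by apply: dual_copositive_mx_outer => [|i]; [case: dB | rewrite mxE ler0n].
  rewrite /e trmx_delta mul_delta_mx; apply/matrixP => i k; rewrite !mxE.
  have nS p : p != u -> p \notin diag_supp B.
    by move=> pu; apply/negP => pS; have := finset.in_set0 p; rewrite -S1 in_setD1 pu pS.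
  have [->|iu] := eqVneq i u; last by rewrite mulr0 dnn_supp0 // nS.
  have [->|ku] := eqVneq k u; first by rewrite mulr1.
  by rewrite mulr0 (sym_entryC _ _ (proj1 (proj1 dB))) dnn_supp0 // nS.
rewrite in_setD1 => /andP[lu lS].
have [Bul|Bul] := eqVneq (B u l) 0; first by apply: (zero_case B u l) => //; rewrite eq_sym.
have [|t [t0 dB' [p [q [pq pS qS Bpq]]]]] := reduce_to_zero dB _ Bul.
  by rewrite eq_sym.
set B' := B - _ in dB' Bpq.
have -> : B = B' + t *: (col u B *m (col u B)^T) by rewrite subrK.
apply: dual_copositive_mxD; last by apply: dual_copositive_mx_outer => // i; rewrite mxE; case: dB.
have S' : diag_supp B' \subset diag_supp B.
  apply/fintype.subsetP => i; apply: contraTT => iS.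
  by rewrite inE !mxE big_ord1 !mxE !(dnn_supp0 _ dB iS) mul0r mulr0 subr0 eqxx.
have [pS'|pS'] := boolP (p \in diag_supp B'); last first.
  apply: IH => //; last exact: leq_trans (subset_leq_card S') S4.
  apply: leq_trans _ (ltnSE ltN); apply: proper_card; rewrite properE S' /=.
  by apply/subsetPn; exists p.
have [qS'|qS'] := boolP (q \in diag_supp B'); last first.
  apply: IH => //; last exact: leq_trans (subset_leq_card S') S4.
  apply: leq_trans _ (ltnSE ltN); apply: proper_card; rewrite properE S' /=.
  by apply/subsetPn; exists q.
exact: (zero_case B' p q).
Qed.

End DoublyNonnegative.

(** * Sizes up to four and the theorem *)

Section SmallSizes.
Variables (R : realType) (k : nat).

(** The inclusion from left to right holds for every k: squares and the symmetric
    matrix units are copositive. *)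
Lemma dual_copositive_doubly_nonneg : (k <= 4)%N ->
  dual_cone (copositive R k) = [set B | doubly_nonneg (vsval B)]%classic.
Proof.
move=> k4; apply/seteqP; split=> [B dB|B dB A cA] /=.
  split=> [|i l].
    split=> [|x]; first exact: symM_tr.
    by rewrite -sprod_outer sprodC; apply: dB; exact: copositive_outer.
  have sE : (symdelta R i l)^T = symdelta R i l.
    by rewrite /symdelta linearZ linearD /= !trmx_delta addrC.
  have /dB : copositive R k (mksym (symdelta R i l)).
    move=> x x0; rewrite mksymK // -[X in 0 <= X]/(bform _ x x) bformE.
    apply: sumr_ge0 => p _; apply: sumr_ge0 => q _; rewrite !mxE.
    by rewrite !mulr_ge0 ?invr_ge0 ?addr_ge0 ?ler0n.
  rewrite -[sprod _ _]/(mxdot _ _) mksymK // mxdotZl mxdotDl.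
  have mxdot_delta p q : mxdot (delta_mx p q) (vsval B) = vsval B p q.
    rewrite /mxdot (bigD1 p) //= [X in _ + X]big1 => [|s sp]; last first.
      by rewrite big1 // => t _; rewrite mxE (negPf sp) mul0r.
    rewrite addr0 (bigD1 q) //= big1 => [|t tq]; last by rewrite mxE (negPf tq) andbF mul0r.
    by rewrite mxE !eqxx mul1r addr0.
  rewrite !mxdot_delta (sym_entryC l i (symM_tr B)); lra.
by apply: dnn_dual_copositive => //; rewrite (leq_trans (max_card _)) // card_ord.
Qed.

(** One block carries the matrix B itself, and one block for each entry of B carries
    this entry as a multiple of a fixed square e e^T, which is positive semidefinite
    exactly when the entry is nonnegative. *)
Lemma dnn_lift : (0 < k)%N ->
  has_sdp_lift [set B : symM R k | doubly_nonneg (vsval B)]%classic k.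
Proof.
move=> k0; split=> //.
pose I := option ('I_k * 'I_k).
exists #|{: I}|; split; first by apply/card_gt0P; exists None.
pose e : 'cV[R]_k := delta_mx (Ordinal k0) 0.
pose f (B : symM R k) : {ffun 'I_(#|{: I}|) -> symM R k} :=
  [ffun i => if enum_val i is Some pq then vsval B pq.1 pq.2 *: outer e else B].
have f_lin : linear f.
  move=> a x y; apply/ffunP => i; rewrite !ffunE; case: (enum_val i) => [[p q]|] //=.
  by rewrite !mxE scalerDl scalerA.
have f0 : f 0 = 0 by have [g gE] := lfun_of_linear f_lin; rewrite -gE linear0.
have [|a [x1 z1] [x2 z2] /= -> ->|G GE] := @vspace_of_pred _
   (symM R k * {ffun 'I_(#|{: I}|) -> symM R k})%type (fun xz => xz.2 = f xz.1).
- by rewrite /= f0.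
- by rewrite f_lin.
suff -> : [set B : symM R k | doubly_nonneg (vsval B)]%classic =
    [set x | exists z, psd_power z /\ (x, z) \in G]%classic.
  apply: lift_of_graph => x /GE /= /ffunP/(_ (enum_rank None)).
  by rewrite !ffunE enum_rankK.
apply/seteqP; split=> [B [pB B0]|B [z [pz /GE /= zE]]] /=.
  exists (f B); split; last exact/GE.
  move=> i; rewrite ffunE; case: (enum_val i) => [[p q]|]; last exact/psdP.
  by apply/psdP; rewrite linearZ /= outerK; apply: psdmxZ => //; exact: psdmx_outer.
split=> [|p q].
  by apply/psdP; have := pz (enum_rank None); rewrite zE ffunE enum_rankK.
have := pz (enum_rank (Some (p, q))); rewrite zE ffunE enum_rankK /= => /psdP[_ /(_ e)].
rewrite linearZ /= qformZm outerK qform_outer.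
have -> : (e^T *m e) 0 0 = 1 by rewrite /e trmx_delta mul_delta_mx mxE eqxx.
by rewrite expr1n mulr1.
Qed.

End SmallSizes.

Lemma sxdeg_ge (R : realType) (V : lmodType R) (S : set V) k :
  (forall j, has_sdp_lift S j -> (k <= j)%N) -> (k%:Z%:E <= sxdeg S)%E.
Proof.
move=> h; rewrite /sxdeg; case: pselect => [ex_j|_]; last exact: leey.
by case: ex_minnP => j /asboolP/h kj _; rewrite lee_fin lez_nat.
Qed.

Lemma sxdeg_le (R : realType) (V : lmodType R) (S : set V) k :
  has_sdp_lift S k -> (sxdeg S <= k%:Z%:E)%E.
Proof.
move=> h; rewrite /sxdeg; case: pselect => [ex_j|]; last by case; exists k; apply/asboolP.
by case: ex_minnP => j _ min_j; rewrite lee_fin lez_nat; apply/min_j/asboolP.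
Qed.

Lemma eq_sxdeg (R : realType) (V : lmodType R) (S S' : set V) :
  (forall j, has_sdp_lift S j <-> has_sdp_lift S' j) -> sxdeg S = sxdeg S'.
Proof.
move=> h; rewrite /sxdeg; have -> : has_sdp_lift S = has_sdp_lift S'.
  by apply/funext => j; apply/propext.
by [].
Qed.

Theorem corollary16 (R : realType) (k : nat) (hk : (0 < k)%N) :
  [/\ sxdeg (copositive R k) = sxdeg (dual_cone (copositive R k)),
      (k%:Z%:E <= sxdeg (dual_cone (copositive R k)))%E
    & (k <= 4)%N ->
      sxdeg (copositive R k) = k%:Z%:E /\
      sxdeg (dual_cone (copositive R k)) = k%:Z%:E].
Proof.
have eq_deg : sxdeg (copositive R k) = sxdeg (dual_cone (copositive R k)).
  by apply: eq_sxdeg => j; exact: sdp_lift_dual.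
have lower : (k%:Z%:E <= sxdeg (dual_cone (copositive R k)))%E.
  apply: sxdeg_ge => j [_ [m [_ hl]]]; apply: (@factor_lower_bound R k j m).
  apply: factor_of_lift hl _ _ => [x _|x y dx cy].
    by rewrite -[sprod _ _]/(mxdot _ _) linear0 mxdotC mxdot0l.
  by rewrite sprodC; exact: dx.
split=> // k4.
have deg : sxdeg (dual_cone (copositive R k)) = k%:Z%:E.
  apply/eqP; rewrite eq_le lower andbT; apply: sxdeg_le.
  by rewrite dual_copositive_doubly_nonneg //; exact: dnn_lift.
by rewrite eq_deg.
Qed.
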